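(* For each non-empty open interval $I \subset (1, \infty)$, the set of $\theta \in I$ for which the sequence $(\theta^k)_{k \geq 0}$ is not dense modulo $1$ has Hausdorff dimension $1$.
   Context: A sequence of real numbers is dense modulo $1$ if its image in $\mathbb{R}/\mathbb{Z}$ is dense (equivalently, the sequence of its fractional parts is dense in $[0,1)$). *)

(* Defs.v *)
From HB Require Import structures.
From mathcomp Require Import all_boot all_order all_algebra generic_quotient.
From mathcomp Require Import all_classical all_reals all_analysis.

Set Implicit Arguments.
Unset Strict Implicit.
Unset Printing Implicit Defensive.
Import Order.TTheory GRing.Theory Num.Theory.
Import numFieldNormedType.Exports.

Local Open Scope classical_set_scope.
Local Open Scope ring_scope.

Section hausdorff_dimension.
Context {R : realType}.
Implicit Types (A U : set R) (s : R).
Local Open Scope ereal_scope.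

(* The maximum with 0 makes the diameter of the empty set 0 instead of -oo. *)
Definition diameter A : \bar R :=
  maxe 0 (ereal_sup [set `|xy.1 - xy.2|%:E | xy in A `*` A]).

(* The case distinction only matters for s = 0: singletons have weight
   0 `^ 0 = 1, so that the 0-dimensional measure counts points, while the empty
   set, used to pad finite covers, always has weight 0. *)
Definition hausdorff_weight s U : \bar R :=
  if U == set0 then 0 else diameter U `^ s.

Definition hausdorff_premeasure s (delta : R) A : \bar R :=
  ereal_inf [set \sum_(0 <= k <oo) hausdorff_weight s (U k) | U in
    [set U : (set R)^nat | A `<=` \bigcup_k U k /\
                           forall k, diameter (U k) <= delta%:E]].

(* The premeasure is nonincreasing in delta, so this supremum is its limit as
   delta tends to 0 from the right. *)
Definition hausdorff_measure s A : \bar R :=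
  ereal_sup [set hausdorff_premeasure s delta A | delta in
    [set delta : R | (0 < delta)%R]].

Definition hausdorff_dim A : \bar R :=
  ereal_inf [set s%:E | s in
    [set s : R | (0 <= s)%R /\ hausdorff_measure s A = 0]].

End hausdorff_dimension.

Section reals_mod1.
Context {R : realType}.
Implicit Types x y z : R.

Definition eqmod1 x y : bool := x - y \is a Num.int.

Lemma eqmod1_refl : reflexive eqmod1.
Proof. by move=> x; rewrite /eqmod1 subrr. Qed.

Lemma eqmod1_sym : symmetric eqmod1.
Proof. by move=> x y; rewrite /eqmod1 -opprB rpredN. Qed.

Lemma eqmod1_trans : transitive eqmod1.
Proof.
move=> y x z; rewrite /eqmod1 => xy yz.
by rewrite -(subrK y x) -addrA rpredD.
Qed.

Canonical eqmod1_equiv := EquivRel eqmod1 eqmod1_refl eqmod1_sym eqmod1_trans.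

End reals_mod1.

(* R/Z with the quotient topology. *)
Definition RmodZ (R : realType) :=
  quotient_topology {eq_quot (@eqmod1_equiv R)}%qT.
HB.instance Definition _ (R : realType) := Topological.on (RmodZ R).
HB.instance Definition _ (R : realType) := Quotient.on (RmodZ R).

Definition dense_mod1 (R : realType) (u : R^nat) : Prop :=
  dense (range (fun k => \pi_(RmodZ R)%qT (u k))).

Section dense_mod1_theory.
Context {R : realType}.

Lemma eq_RmodZ (x y : R) :
  \pi_(RmodZ R)%qT x = \pi_(RmodZ R)%qT y <-> x - y \is a Num.int.
Proof.
by split=> [/eqmodP|xy]; last exact/eqmodP.
Qed.

Lemma dense_mod1_fractional (u : R^nat) :
  dense_mod1 u <->
  [set` `[0, 1[] `<=` closure (range (fun k => u k - (Num.floor (u k))%:~R)).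
Proof.
split=> [du x /= + V|cu O [c Oc] oO].
  rewrite in_itv/= => /andP[x0 x1] /nbhs_ballP[e /= e0 xeV].
  pose W := ball x e `&` `]0, 1[.
  have oW : open W by apply: openI; [exact: ball_open|exact: itv_open].
  pose P := \bigcup_(m : int) ((fun y : R => y - m%:~R) @^-1` W).
  have oP : open P.
    apply: bigcup_open => m _; apply: open_comp => // y _.
    by apply: cvgB; [exact: cvg_id|exact: cvg_cst].
  pose O := \pi_(RmodZ R)%qT @` W.
  have piO : \pi_(RmodZ R)%qT @^-1` O = P.
    apply/seteqP; split => y /=.
      move=> [w Ww] /eq_RmodZ /intrP[m wym]; exists (- m) => //=.
      by rewrite rmorphN/= opprK -wym addrCA subrr addr0.
    move=> [m _ /= Wy]; exists (y - m%:~R) => //; apply/eq_RmodZ.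
    by rewrite addrC addKr rpredN intr_int.
  have oO : open O by rewrite /open/= /quotient_open piO.
  have O0 : O !=set0.
    pose d := Num.min e (1 - x).
    have d0 : 0 < d by rewrite lt_min e0 subr_gt0.
    have dd : d / 2 < d by rewrite ltr_pdivrMr// ltr_pMr// ltr1n.
    have d20 : 0 < d / 2 by rewrite divr_gt0.
    have [de dx] : d <= e /\ d <= 1 - x by rewrite /d !ge_min !lexx orbT.
    exists (\pi_(RmodZ R)%qT (x + d / 2)); exists (x + d / 2) => //; split => /=.
      rewrite /ball/= opprD addNKr normrN gtr0_norm//.
      exact: lt_le_trans dd de.
    rewrite in_itv/= ltr_wpDl//= addrC -ltrBrDr; exact: lt_le_trans dd dx.
  have [_ [/[swap]] [k _ <-] Ok] := du O O0 oO.
  have : P (u k) by rewrite -piO.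
  move=> [m _ [xum /=]]; rewrite in_itv/= subr_gt0 ltrBlDr => /andP[mu um].
  exists (u k - m%:~R); split; last exact: xeV.
  exists k => //; rewrite (@floor_def _ _ m)// (ltW mu) intrD addrC/=.
  by rewrite addrC [_ + 1%:~R]addrC.
pose x : R := repr c.
have xc : \pi_(RmodZ R)%qT x = c by rewrite reprK.
have piF (y : R) :
    \pi_(RmodZ R)%qT (y - (Num.floor y)%:~R) = \pi_(RmodZ R)%qT y.
  by apply/eq_RmodZ; rewrite addrC addKr rpredN intr_int.
have x01 : [set` `[0, 1[] (x - (Num.floor x)%:~R).
  have := floor_itv x; rewrite intrD => /andP[fx xf].
  by rewrite /= in_itv/= subr_ge0 fx ltrBlDl.
have [|_ [[k _ <-] /= Ok]] := cu _ x01 (\pi_(RmodZ R)%qT @^-1` O).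
  by apply: open_nbhs_nbhs; split => //=; rewrite piF xc.
by exists (\pi_(RmodZ R)%qT (u k)); split; [rewrite -piF|exists k].
Qed.

End dense_mod1_theory.

(* Main.v *)
Require Import Defs.
From mathcomp Require Import all_boot all_order all_algebra.
From mathcomp Require Import all_classical all_reals all_analysis.
From mathcomp Require Import ring lra zify.
Import Order.TTheory GRing.Theory Num.Theory.
Import numFieldNormedType.Exports.

Set Implicit Arguments.
Unset Strict Implicit.
Unset Printing Implicit Defensive.

Local Open Scope classical_set_scope.
Local Open Scope ring_scope.

(** The upper bound on the dimension holds for every subset of a half-line
    (hausdorff_measure_half_line). For the lower bound, fix s < 1 and a closed segment with left endpoint a > 1
    inside the interval. Every countable cover U of small enough s-weight is shown
    to miss a point theta of that segment whose powers, from some exponent on,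
    have no fractional part in some interval ]0, e[; such a point has a nondense
    sequence of powers (not_dense_mod1), so the s-dimensional measure of the set
    is not 0.

    The point theta is the intersection of nested segments, each being one of the
    m = 4 N equal children of the previous one (exists_escape). On a segment of
    left endpoint x and length l, the power with exponent k stretches lengths by
    about speed k x = k x^(k-1), and one only treats the k for which the image has
    length l speed k x between 1 / (4 m) and 1 / 4. This image is too short to
    contain points just above two different integers, so the points to be avoided
    for k form a single cluster, which is shorter than a child for
    e = 1 / (4 m^2) (returns_close). It thus touches at most two
    children. The speeds grow at least geometrically with ratio a in k, so that
    only N exponents are treated when a^N >= m (meeting_weight_returns_le), and at
    most 2 N children, that is half of them, are spoilt. However close a is to 1,
    a large N satisfies this condition.

    Simultaneously, the weight of the members of U that meet the current segment is
    kept below (l / m)^s. Such members are shorter than a child, hence meet at most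
    two children, and an averaging argument yields an unspoilt child that carries
    at most the fraction 1 / N of the weight (exists_light_child). The bound is
    inherited by that child if m^s <= N, which is true for N large because s < 1
    (branching_exists). In the limit theta lies in no member of U: the weight of
    such a member would be below (l / m)^s for all the lengths l, hence 0 if s > 0,
    whereas the weights are first made positive by an arbitrarily small summable
    amount. *)

(** * Hausdorff measures of subsets of the half-line *)

Section hausdorff_theory.
Context {R : realType}.
Implicit Types (A B U : set R) (s d e : R).

Lemma diameter_ge0 A : (0 <= diameter A)%E.
Proof. by rewrite /diameter le_max lexx. Qed.

Lemma diameter_le A d : 0 <= d ->
  (forall x y, A x -> A y -> `|x - y| <= d) -> (diameter A <= d%:E)%E.
Proof.
move=> d0 Ad; rewrite /diameter ge_max lee_fin d0/=.
by apply: ge_ereal_sup => _ [[x y] /= [Ax Ay] <-]; rewrite lee_fin Ad.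
Qed.

Lemma dist_le_diameter A x y : A x -> A y -> (`|x - y|%:E <= diameter A)%E.
Proof.
move=> Ax Ay; rewrite /diameter le_max; apply/orP; right.
by apply: ereal_sup_ubound; exists (x, y).
Qed.

Lemma hausdorff_weight_ge0 s U : (0 <= hausdorff_weight s U)%E.
Proof. by rewrite /hausdorff_weight; case: ifP => // _; exact: poweR_ge0. Qed.

Lemma hausdorff_weight_le s U d : 0 <= s -> 0 <= d ->
  (diameter U <= d%:E)%E -> (hausdorff_weight s U <= (d `^ s)%:E)%E.
Proof.
move=> s0 d0 Ud; rewrite /hausdorff_weight; case: ifP => _.
  by rewrite lee_fin powR_ge0.
rewrite -poweR_EFin; apply: gt0_ler_poweR => //; rewrite in_itv/= ?leey ?andbT.
- exact: diameter_ge0.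
- by rewrite lee_fin.
Qed.

Lemma hausdorff_measure_eq0 s A :
  (forall delta e, 0 < delta -> 0 < e ->
    exists U : (set R)^nat, [/\ A `<=` \bigcup_k U k,
      forall k, (diameter (U k) <= delta%:E)%E &
      (\sum_(0 <= k <oo) hausdorff_weight s (U k) <= e%:E)%E]) ->
  hausdorff_measure s A = 0%E.
Proof.
move=> small; apply/eqP; rewrite eq_le; apply/andP; split.
  apply: ge_ereal_sup => _ [delta /= delta0 <-].
  apply/lee_addgt0Pr => e e0; rewrite add0e; apply: ge_ereal_inf.
  have [U [AU Ud Ue]] := small _ _ delta0 e0.
  by eexists; last exact: Ue; exists U.
apply: (@le_trans _ _ (hausdorff_premeasure s 1 A)).
  apply: le_ereal_inf_tmp => _ [U _ <-].
  by apply: nneseries_ge0 => k _ _; exact: hausdorff_weight_ge0.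
by apply: ereal_sup_ubound; exists 1 => /=.
Qed.

Lemma hausdorff_measure_eq0_cover s A delta e :
  hausdorff_measure s A = 0%E -> 0 < delta -> 0 < e ->
  exists U : (set R)^nat, [/\ A `<=` \bigcup_k U k,
    forall k, (diameter (U k) <= delta%:E)%E &
    (\sum_(0 <= k <oo) hausdorff_weight s (U k) < e%:E)%E].
Proof.
move=> A0 delta0 e0; have : (hausdorff_premeasure s delta A < e%:E)%E.
  apply: (@le_lt_trans _ _ 0%E); last by rewrite lte_fin.
  by rewrite -A0; apply: ereal_sup_ubound; exists delta.
by case/ereal_inf_lt => _ [U [AU U1] <-] Ue; exists U.
Qed.

Lemma subset_hausdorff_measure_eq0 s A B : A `<=` B ->
  hausdorff_measure s B = 0%E -> hausdorff_measure s A = 0%E.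
Proof.
move=> AB B0; apply: hausdorff_measure_eq0 => delta e delta0 e0.
have [U [BU Ud Ue]] := hausdorff_measure_eq0_cover B0 delta0 e0.
by exists U; split=> //; [exact: subset_trans BU|exact: ltW].
Qed.

(** Cauchy condensation: the 2 ^ m terms with 2 ^ m - 1 <= k < 2 ^ (m + 1) - 1 add up
    to at most q ^ m, where q = 2 ^ (1 - s) < 1. *)
Lemma riemann_series_bounded s : 1 < s ->
  exists2 C, 0 < C & forall n, \sum_(0 <= k < n) k.+1%:R^-1 `^ s <= C :> R.
Proof.
move=> s1; pose q : R := 2 `^ (1 - s).
have q0 : 0 < q by exact: powR_gt0.
have q1 : q < 1.
  rewrite /q -[ltRHS](@powRr0 _ (2 : R)) /powR pnatr_eq0/= ltr_expR.
  by rewrite ltr_pM2r ?ln_gt0 ?ltr1n// subr_lt0.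
have q10 : 0 < 1 - q by rewrite subr_gt0.
have blocks m : \sum_(0 <= k < 2 ^ m - 1) k.+1%:R^-1 `^ s <=
    (1 - q ^+ m) / (1 - q) :> R.
  elim: m => [|m IH]; first by rewrite expn0 subnn big_geq// expr0 subrr mul0r.
  have m2 : (0 < 2 ^ m)%N by rewrite expn_gt0.
  rewrite (@big_cat_nat _ _ _ (2 ^ m - 1)) ?leq_sub2r ?leq_exp2l//=.
  have -> : (1 - q ^+ m.+1) / (1 - q) = (1 - q ^+ m) / (1 - q) + q ^+ m.
    by rewrite exprS; field; rewrite gt_eqF.
  apply: lerD => //.
  have -> : q ^+ m = \sum_(2 ^ m - 1 <= k < 2 ^ m.+1 - 1) (2 ^+ m)^-1 `^ s.
    rewrite sumr_const_nat (_ : (_ - _ = 2 ^ m)%N); last by rewrite expnS; lia.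
    rewrite -(mulr_natl ((2 ^+ m)^-1 `^ s)) natrX /q -!powR_mulrn ?powR_ge0//.
    rewrite -powRN -!powRrM -powRD; last first.
      by apply/implyP => _; rewrite pnatr_eq0.
    by congr (_ `^ _); ring.
  rewrite big_seq_cond [leRHS]big_seq_cond; apply: ler_sum => k.
  rewrite mem_index_iota => /andP[/andP[mk _] _].
  apply: ge0_ler_powR; rewrite ?nnegrE ?invr_ge0 ?exprn_ge0//; first lra.
  by rewrite lef_pV2 ?posrE ?ltr0n ?exprn_gt0// -natrX ler_nat; lia.
exists (1 - q)^-1; first by rewrite invr_gt0.
move=> n; apply: (@le_trans _ _ ((1 - q ^+ n) / (1 - q))); last first.
  rewrite ler_piMl ?invr_ge0 1?ltW// ltrBlDr ltrDl.
  exact: exprn_gt0.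
apply: le_trans (blocks n); rewrite (@big_cat_nat _ _ _ n _ (2 ^ n - 1)) //=; last first.
  by have := ltn_expl n (isT : 1 < 2)%N; lia.
by rewrite lerDl; apply: sumr_ge0 => k _; exact: powR_ge0.
Qed.

(** The half-line is tiled by the intervals whose endpoints are consecutive
    partial sums of c / (k + 1): they cover because the harmonic series diverges,
    and they are small because the series of the 1 / (k + 1)^s converges. *)
Lemma hausdorff_measure_half_line s A a : 1 < s ->
  A `<=` [set` `[a, +oo[] -> hausdorff_measure s A = 0%E.
Proof.
move=> s1 Aa; apply: hausdorff_measure_eq0 => delta e delta0 e0.
have [C C0 sumC] := riemann_series_bounded s1.
pose c := Num.min (Num.min 1 delta) (e / C).
have c0 : 0 < c by rewrite !lt_min ltr01 delta0 divr_gt0.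
have [c1 cdelta ce] : [/\ c <= 1, c <= delta & c <= e / C].
  by rewrite /c !ge_min !lexx !orbT.
pose H := series (@harmonic R).
have HS k : H k.+1 = H k + k.+1%:R^-1 by rewrite /H /series/= big_nat_recr.
pose U k := [set` `[a + c * H k, a + c * H k.+1]].
have Ud k : (diameter (U k) <= (c * k.+1%:R^-1)%:E)%E.
  apply: diameter_le => [|x y]; first by rewrite mulr_ge0 ?invr_ge0// ltW.
  rewrite /U/= !in_itv/= HS mulrDr addrA ler_distlC.
  move: (c * H k) (c * _^-1) => u v.
  by move=> /andP[? ?] /andP[? ?]; apply/andP; split; lra.
exists U; split.
- move=> x Ax; have ax : a <= x.
    by have := Aa _ Ax; rewrite /= in_itv/= andbT.
  have [n xn] : exists n, x < a + c * H n.
    have Hoo : H @ \oo --> +oo.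
      apply: nondecreasing_dvgn_lt; last exact: dvg_harmonic.
      by apply/nondecreasing_seqP => n; rewrite HS lerDl invr_ge0.
    move/cvgryPgt : Hoo => /(_ ((x - a) / c)) [n _ /(_ n (leqnn n))].
    by rewrite ltr_pdivrMr// => xn; exists n; lra.
  elim: n xn => [|n IH] xn.
    by move: xn; rewrite /H /series/= big_geq// mulr0 addr0 ltNge ax.
  have [/IH//|xn'] := ltP x (a + c * H n).
  by exists n => //; rewrite /U/= in_itv/= xn' ltW.
- move=> k; apply: le_trans (Ud k) _; rewrite lee_fin.
  apply: le_trans cdelta; rewrite ler_piMr// ?invf_le1 ?ler1n//; exact: ltW.
apply: lime_le.
  by apply: is_cvg_nneseries => k _ _; exact: hausdorff_weight_ge0.
apply: nearW => n; apply: (@le_trans _ _ (\sum_(0 <= k < n)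
    (c * k.+1%:R^-1 `^ s)%:E)%E).
  apply: lee_sum => k _.
  have k0 : 0 <= k.+1%:R^-1 :> R by rewrite invr_ge0.
  apply: le_trans (hausdorff_weight_le _ _ (Ud k)) _; first lra.
    by rewrite mulr_ge0// ltW.
  rewrite lee_fin powRM ?(ltW c0)//.
  by rewrite ler_wpM2r ?powR_ge0// ge1r_powR ?c0// ltW.
rewrite sumEFin lee_fin -big_distrr/=.
apply: le_trans (_ : c * C <= _); first by rewrite ler_wpM2l ?sumC// ltW.
by rewrite -ler_pdivlMr.
Qed.

End hausdorff_theory.

(** * The number of children met by a short set *)

Section segments.
Context {R : realType}.
Implicit Types (x y z l h : R) (w : nat -> R) (U V : (set R)^nat) (J : set R).

Lemma sum_window_le (p : pred nat) (c n : nat) (b : R) : 0 <= b ->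
  (forall i j, p i -> p j -> (j < i + c)%N) ->
  \sum_(0 <= i < n | p i) b <= c%:R * b.
Proof.
move=> b0 pc; rewrite big_const_seq iter_addr_0 mulr_natl.
apply: ler_wpMn2l => //.
have [/hasP[i _ pi]|nop] := boolP (has p (index_iota 0 n)); last first.
  by move: nop; rewrite has_count -leqNgt leqn0 => /eqP ->.
have [i0 pi0 i0_min] := ex_minnP (ex_intro (fun i => p i) i pi).
rewrite -size_filter -[leqRHS](size_iota i0).
apply: uniq_leq_size; first by rewrite filter_uniq ?iota_uniq.
by move=> j; rewrite mem_filter mem_iota => /andP[pj _]; rewrite i0_min ?pc.
Qed.

Definition seg x l : set R := [set` `[x, x + l]].

Definition meeting_weight w V J : \bar R :=
  (\sum_(0 <= k <oo | `[< V k `&` J !=set0 >]) (w k)%:E)%E.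

Lemma meeting_weight_ge0 w V J : (forall k, 0 <= w k) ->
  (0 <= meeting_weight w V J)%E.
Proof. by move=> w0; apply: nneseries_ge0 => k _ _; rewrite lee_fin. Qed.

Lemma le_meeting_weight w V J k : (forall k, 0 <= w k) ->
  V k `&` J !=set0 -> ((w k)%:E <= meeting_weight w V J)%E.
Proof.
move=> w0 VJ; rewrite /meeting_weight (@nneseriesD1 _ _ k); last 2 first.
- by move=> i _; rewrite lee_fin.
- exact/asboolP.
by rewrite leeDl// nneseries_ge0// => i _ _; rewrite lee_fin.
Qed.

Definition child x h (t : nat) : set R := seg (x + t%:R * h) h.

Lemma child_sub x h (n t : nat) : 0 < h -> (t < n)%N ->
  child x h t `<=` seg x (n%:R * h).
Proof.
move=> h0 tn y; rewrite /child /seg /= !in_itv/= => /andP[ty yt].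
have : t.+1%:R * h <= n%:R * h by rewrite ler_wpM2r ?ler_nat// ltW.
rewrite mulrSr mulrDl mul1r => tnh.
have th0 : 0 <= t%:R * h by rewrite mulr_ge0// ltW.
by apply/andP; split; lra.
Qed.

(** A set whose points are less than h apart meets at most two of the
    consecutive segments of length h. *)
Lemma sum_meeting_weight_child w V x h n : 0 < h -> (forall k, 0 <= w k) ->
  (forall k y z, (V k `&` seg x (n%:R * h)) y ->
    (V k `&` seg x (n%:R * h)) z -> `|y - z| < h) ->
  (\sum_(0 <= t < n) meeting_weight w V (child x h t) <=
    2%:E * meeting_weight w V (seg x (n%:R * h)))%E.
Proof.
move=> h0 w0 Vh; rewrite /meeting_weight.
under eq_bigr do rewrite eseries_mkcond.
rewrite [X in (_ * X)%E]eseries_mkcond -nneseriesZl; last first.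
  by move=> k _; case: ifP => _; rewrite ?lee_fin.
rewrite -nneseries_sum_nat; last first.
  by move=> t k; case: ifP => _; rewrite ?lee_fin.
apply: lee_nneseries => [k _ _|k _].
  by apply: sume_ge0 => t _; case: ifP => _; rewrite ?lee_fin.
case: asboolP => [_|VJ]; last first.
  rewrite mule0 big_nat_cond big1// => t /andP[/andP[_ tn] _].
  rewrite asboolF// => -[y [Vy ty]]; apply: VJ.
  by exists y; split => //; exact: child_sub ty.
pose p t := (t < n)%N && `[< V k `&` child x h t !=set0 >].
rewrite (_ : (\sum_(_ <= _ < _) _)%E = (\sum_(0 <= t < n | p t) w k)%:E).
  rewrite -EFinM lee_fin; apply: sum_window_le => // i j.
  move=> /andP[ni /asboolP[y [Vy iy]]] /andP[nj /asboolP[z [Vz jz]]].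
  have := Vh k y z (conj Vy (child_sub h0 ni iy)) (conj Vz (child_sub h0 nj jz)).
  move: iy jz; rewrite /child /seg /= !in_itv/= ltr_norml.
  move=> /andP[iy yi] /andP[jz zj] /andP[yz zy].
  rewrite -(ltr_nat R) -(ltr_pM2r h0) natrD mulrDl; lra.
rewrite -sumEFin -big_mkcond/= big_nat_cond [RHS]big_nat_cond.
by apply: eq_bigl => t; rewrite /p /=; case: (t < n)%N.
Qed.

(** For a child, add the number of the V k that it meets to N / L times the weight
    that it carries: over the 4 N children this totals less than 2 N + 2 N, so the
    value at some child is less than 1. *)
Lemma exists_light_child V U w x l h L (N : nat) : 0 < h -> 0 < L ->
  (0 < N)%N -> (forall k, 0 <= w k) ->
  l = (4 * N)%:R * h ->
  (forall k y z, (V k `&` seg x l) y -> (V k `&` seg x l) z -> `|y - z| < h) ->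
  (forall k y z, (U k `&` seg x l) y -> (U k `&` seg x l) z -> `|y - z| < h) ->
  (meeting_weight (fun=> 1%R) V (seg x l) <= N%:R%:E)%E ->
  (meeting_weight w U (seg x l) < L%:E)%E ->
  exists t, [/\ (t < 4 * N)%N, forall k, ~ (V k `&` child x h t !=set0) &
    (meeting_weight w U (child x h t) < (L / N%:R)%:E)%E].
Proof.
move=> h0 L0 N0 w0 -> Vh Uh VN UL; pose J := seg x ((4 * N)%:R * h).
have N0' : 0 < N%:R :> R by rewrite ltr0n.
have one0 (k : nat) : 0 <= 1 :> R by [].
pose F t := (meeting_weight (fun=> 1%R) V (child x h t) +
  (N%:R / L)%:E * meeting_weight w U (child x h t))%E.
have NL0 : (0 <= (N%:R / L)%:E)%E by rewrite lee_fin divr_ge0// ltW.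
have Fsum : (\sum_(0 <= t < 4 * N) F t < (4 * N)%:R%:E)%E.
  rewrite big_split/= -ge0_sume_distrr; last first.
    by move=> t _; exact: meeting_weight_ge0.
  have V2 := sum_meeting_weight_child h0 one0 Vh.
  have U2 := sum_meeting_weight_child h0 w0 Uh.
  apply: (@le_lt_trans _ _ (2%:E * N%:R%:E +
      (N%:R / L)%:E * (2%:E * meeting_weight w U J))%E).
    apply: leeD.
      by apply: le_trans V2 _; rewrite lee_wpmul2l.
    by rewrite lee_wpmul2l.
  have : meeting_weight w U J \is a fin_num.
    rewrite ge0_fin_numE; first exact: lt_trans UL (ltry _).
    exact: meeting_weight_ge0.
  move=> /fineK UJ; move: UL; rewrite -UJ lte_fin => UL.
  rewrite -!EFinM -EFinD lte_fin natrM.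
  have -> : 4%:R * N%:R = 2 * N%:R + N%:R / L * (2 * L) :> R.
    by field; rewrite gt_eqF.
  by rewrite ltrD2l ltr_pM2l ?divr_gt0// ltr_pM2l.
have [t tN Ft1] : exists2 t, (t < 4 * N)%N & (F t < 1)%E.
  apply: contrapT => noF; move: Fsum; apply/negP; rewrite -leNgt.
  rewrite -[leLHS](_ : (\sum_(0 <= t < 4 * N) 1)%E = _); last first.
    by rewrite sumEFin sumr_const_nat subn0.
  rewrite big_nat_cond [leRHS]big_nat_cond; apply: lee_sum => t.
  move=> /andP[/andP[_ tN] _]; rewrite leNgt; apply/negP => Ft.
  by apply: noF; exists t.
have Vt0 := meeting_weight_ge0 V (child x h t) one0.
have Ut0 := meeting_weight_ge0 U (child x h t) w0.
exists t; split=> // [k Vk|].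
  move: Ft1; apply/negP; rewrite -leNgt.
  apply: (le_trans (le_meeting_weight one0 Vk)).
  by rewrite leeDl// mule_ge0.
rewrite -[L / _](@mulKf _ (N%:R / L)) ?gt_eqF ?divr_gt0//.
rewrite EFinM lte_pdivlMl ?divr_gt0//.
apply: (@le_lt_trans _ _ (F t)); first by rewrite leeDr.
by rewrite mulrA divfK ?gt_eqF// divff ?gt_eqF.
Qed.

End segments.

(** * Returns of the powers near the integers *)

Section powers.
Context {R : realType}.
Implicit Types (a b e l m x y z : R).

Definition fractional x : R := x - (Num.floor x)%:~R.

Definition speed (k : nat) x : R := k%:R * x ^+ k.-1.

Lemma subrX_ge_speed (k : nat) x y : 0 <= x -> x <= y ->
  speed k x * (y - x) <= y ^+ k - x ^+ k.
Proof.
move=> x0 xy; have y0 : 0 <= y by exact: le_trans xy.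
rewrite /speed; elim: k => [|[|k] IH]; first by rewrite !mul0r !expr0 subrr.
  by rewrite mul1r expr0 mul1r !expr1.
have -> : y ^+ k.+2 - x ^+ k.+2 =
    y ^+ k.+1 * (y - x) + x * (y ^+ k.+1 - x ^+ k.+1) by rewrite !exprS; ring.
have := ler_wpM2l x0 IH => /= IHx.
have yx : 0 <= y - x by rewrite subr_ge0.
have : x ^+ k.+1 * (y - x) <= y ^+ k.+1 * (y - x).
  by rewrite ler_wpM2r// lerXn2r.
move: IHx; rewrite [in (k.+2)%:R]mulrSr /= !exprS; lra.
Qed.

Lemma subrX_le_speed (k : nat) x y : 0 <= x -> x <= y ->
  y ^+ k - x ^+ k <= speed k y * (y - x).
Proof.
move=> x0 xy; have y0 : 0 <= y by exact: le_trans xy.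
rewrite /speed; elim: k => [|[|k] IH]; first by rewrite !mul0r !expr0 subrr.
  by rewrite mul1r expr0 mul1r !expr1.
have -> : y ^+ k.+2 - x ^+ k.+2 =
    x ^+ k.+1 * (y - x) + y * (y ^+ k.+1 - x ^+ k.+1) by rewrite !exprS; ring.
have := ler_wpM2l y0 IH => /= IHx.
have yx : 0 <= y - x by rewrite subr_ge0.
have : x ^+ k.+1 * (y - x) <= y ^+ k.+1 * (y - x).
  by rewrite ler_wpM2r// lerXn2r.
move: IHx; rewrite [in (k.+2)%:R]mulrSr /= !exprS; lra.
Qed.

(** The image of the segment by the k-th power is short: as
    k l <= l speed k x <= 1 / 4, the speed at most doubles along it. *)
Lemma subrX_seg_le (k : nat) x l y z : 1 <= x -> 0 <= l ->
  l * speed k x <= 4^-1 -> seg x l y -> seg x l z -> y <= z ->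
  z ^+ k - y ^+ k <= 2^-1.
Proof.
rewrite /seg /= !in_itv/= => x1 l0 lk /andP[xy _] /andP[_ zl] yz.
have x0 : 0 <= x by lra.
apply: (@le_trans _ _ ((x + l) ^+ k - x ^+ k)).
  by apply: lerB; rewrite lerXn2r ?nnegrE//; lra.
apply: le_trans (subrX_le_speed k x0 _) _; first lra.
rewrite addrAC subrr add0r; move: lk; rewrite /speed.
have x1k : 1 <= x ^+ k.-1 by rewrite exprn_ege1.
set r := x + l; move: (k.-1) (leq_pred k) x1k => n nk x1n lk.
have kl : l * k%:R <= 4^-1.
  by apply: le_trans lk; rewrite ler_wpM2l// ler_peMr.
have r1 : 1 <= r by rewrite /r; lra.
have rn1 : 1 <= r ^+ n by rewrite exprn_ege1.
have xr : x <= r by rewrite /r; lra.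
have := subrX_le_speed n x0 xr.
rewrite /speed {3}/r addrAC subrr add0r => rx.
have nr : n%:R * r ^+ n.-1 <= k%:R * r ^+ n.
  by rewrite ler_pM ?exprn_ge0 ?ler_nat ?ler_weXn2l ?leq_pred//; lra.
have rx4 : r ^+ n - x ^+ n <= 4^-1 * r ^+ n.
  apply: le_trans rx _; apply: le_trans (_ : k%:R * r ^+ n * l <= _).
    by rewrite ler_wpM2r.
  by rewrite mulrAC ler_wpM2r ?[_ * l]mulrC//; lra.
have : k%:R * r ^+ n * l <= k%:R * (2 * x ^+ n) * l.
  by rewrite ler_wpM2r// ler_wpM2l//; lra.
lra.
Qed.

(** The points of the segment whose k-th power lies just above an integer,
    for the exponents k at which the power expands the segment to a length
    between 1 / (4 m) and 1 / 4. *)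
Definition returns m x l (k : nat) : set R := [set y |
  [/\ seg x l y, (4 * m)^-1 < l * speed k x <= 4^-1 &
    0 < fractional (y ^+ k) < (4 * m ^+ 2)^-1]].

(** All these powers have the same integer part, so they lie in an interval of
    length 1 / (4 m ^ 2), and the power has slope at least 1 / (4 m l). *)
Lemma returns_close m x l (k : nat) y z : 1 <= x -> 0 < l -> 1 <= m ->
  returns m x l k y -> returns m x l k z -> `|y - z| < l / m.
Proof.
move=> x1 l0 m1; wlog yz : y z / y <= z => [wlog ry rz|].
  have [yz|/ltW zy] := leP y z; first exact: wlog.
  by rewrite distrC; exact: wlog.
move=> [yl /andP[ml lk] /andP[fy0 fye]] [zl _ /andP[fz0 fze]].
have m0 : 0 < m by lra.
have e4 : (4 * m ^+ 2)^-1 <= 4^-1.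
  rewrite lef_pV2 ?posrE ?mulr_gt0 ?exprn_gt0//.
  by rewrite ler_peMr// exprn_ege1.
have zy2 := subrX_seg_le x1 (ltW l0) lk yl zl yz.
have xy : x <= y by move: yl; rewrite /seg /= in_itv/= => /andP[].
have y0 : 0 <= y by lra.
have zy0 := subrX_ge_speed k y0 yz.
have sxy : speed k x <= speed k y.
  by rewrite /speed ler_wpM2l// lerXn2r ?nnegrE//; lra.
have s0 : 0 < speed k x.
  rewrite -(pmulr_rgt0 _ l0); apply: lt_trans ml.
  by rewrite invr_gt0 mulr_gt0.
have zy0' : 0 <= z - y by rewrite subr_ge0.
have zyk : y ^+ k <= z ^+ k by rewrite lerXn2r ?nnegrE//; lra.
have fl : Num.floor (z ^+ k) = Num.floor (y ^+ k).
  apply/eqP; rewrite eq_le [X in _ && X]le_floor// andbT leNgt -lezD1.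
  apply/negP; rewrite -(ler_int R) intrD.
  by move: fy0 fye fz0 fze; rewrite /fractional; lra.
have zye : z ^+ k - y ^+ k < (4 * m ^+ 2)^-1.
  by move: fy0 fye fz0 fze; rewrite /fractional fl; lra.
rewrite distrC ger0_norm// -(ltr_pM2l s0).
apply: (@le_lt_trans _ _ (z ^+ k - y ^+ k)).
  by apply: le_trans zy0; rewrite ler_wpM2r.
apply: lt_le_trans zye _.
have -> : (4 * m ^+ 2)^-1 = (4 * m)^-1 / m by field; rewrite gt_eqF.
by rewrite mulrA ler_pM2r ?invr_gt0// [_ * l]mulrC ltW.
Qed.

(** Consecutive speeds grow at least by the factor a, hence the exponents at
    which the segment has returns lie in a window of length N. *)
Lemma meeting_weight_returns_le a m x l (N : nat) : 1 < a -> a <= x -> 0 < l ->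
  0 < m -> m <= a ^+ N ->
  (meeting_weight (fun=> 1%R) (returns m x l) (seg x l) <= N%:R%:E)%E.
Proof.
move=> a1 ax l0 m0 maN; apply: lime_le.
  by apply: is_cvg_nneseries => k _ _.
apply: nearW => n; rewrite sumEFin lee_fin -[leRHS]mulr1.
apply: sum_window_le => // i j.
move=> /asboolP[y [[_ /andP[mi _] _] _]] /asboolP[z [[_ /andP[_ mj] _] _]].
rewrite ltnNge; apply/negP => Nij.
have si : 0 < speed i x.
  by rewrite -(pmulr_rgt0 _ l0); apply: lt_trans mi; rewrite invr_gt0 mulr_gt0.
have i0 : (0 < i)%N by move: si; rewrite /speed; case: i {mi Nij} => //; rewrite mul0r ltxx.
suff : speed i x * m <= speed j x.
  move=> /(ler_wpM2l (ltW l0)); apply/negP; rewrite -ltNge.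
  apply: le_lt_trans mj _; rewrite mulrA -ltr_pdivrMr//.
  by rewrite -invfM.
have x1 : 1 <= x by lra.
apply: (@le_trans _ _ (speed i x * x ^+ N)).
  rewrite ler_wpM2l ?(ltW si)//; apply: le_trans maN _.
  by rewrite lerXn2r ?nnegrE//; lra.
rewrite /speed -mulrA -exprD ler_pM ?exprn_ge0 ?ler_nat//; [lra|lia|].
by rewrite ler_weXn2l//; lia.
Qed.

End powers.

(** * Escaping both a cover and the returns *)

Section escape.
Context {R : realType}.
Variables (a s : R) (N : nat) (U : (set R)^nat) (w : nat -> R).
Let m : R := (4 * N)%:R.
Hypotheses (a_gt1 : 1 < a) (s_ge0 : 0 <= s) (N_gt0 : (0 < N)%N).
Hypotheses (m_le_aN : m <= a ^+ N) (ms_le_N : m `^ s <= N%:R).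
Hypothesis w_gt0 : forall k, 0 < w k.
Hypothesis dist_le_w : forall k y z, U k y -> U k z -> `|y - z| `^ s <= w k.
Implicit Types (x y l theta : R) (i j k : nat).

Let m_ge4 : 4 <= m.
Proof. by rewrite /m ler_nat; lia. Qed.

Let m_gt0 : 0 < m. Proof. by have := m_ge4; lra. Qed.

Let w_ge0 k : 0 <= w k. Proof. exact: ltW. Qed.

(** The threshold (l / m)^s forces every member of the cover that meets the
    segment to be shorter than a child. From one generation to the next it drops
    by the factor m^s <= N, while the weight carried by the light child drops at
    least by the factor N. *)
Lemma exists_next_seg x l : a <= x -> 0 < l ->
  (meeting_weight w U (seg x l) < ((l / m) `^ s)%:E)%E ->
  exists y, [/\ x <= y, y + l / m <= x + l,
    (meeting_weight w U (seg y (l / m)) < ((l / m / m) `^ s)%:E)%E &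
    forall k theta, seg y (l / m) theta -> ~ returns m x l k theta].
Proof.
move=> ax l0 Ul; pose h := l / m.
have h0 : 0 < h by rewrite divr_gt0.
have lE : l = (4 * N)%:R * h by rewrite -/m /h mulrC divfK ?gt_eqF.
have hs0 : 0 < h `^ s by exact: powR_gt0.
have x1 : 1 <= x by exact: le_trans (ltW a_gt1) ax.
have m1 : 1 <= m by apply: le_trans m_ge4; rewrite ler1n.
have [||||t [tN tV tU]] := @exists_light_child R (returns m x l) U w x
    l h (h `^ s) N h0 hs0 N_gt0 w_ge0 lE => //.
- by move=> k y z [ry _] [rz _]; exact: returns_close ry rz.
- move=> k y z [Uy ly] [Uz _]; rewrite ltNge; apply/negP => hyz.
  have := le_lt_trans (le_meeting_weight w_ge0 (ex_intro _ y (conj Uy ly))) Ul.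
  rewrite lte_fin ltNge => /negP; apply; apply: le_trans (dist_le_w Uy Uz).
  by apply: ge0_ler_powR; rewrite ?nnegrE// ltW.
- exact: meeting_weight_returns_le ax l0 m_gt0 m_le_aN.
have t0 : 0 <= t%:R * h by rewrite mulr_ge0// ltW.
have th : t.+1%:R * h <= l by rewrite lE ler_wpM2r ?ler_nat// ltW.
exists (x + t%:R * h); split.
- by rewrite lerDl.
- by move: th; rewrite -/h mulrSr mulrDl mul1r; lra.
- apply: lt_le_trans tU _; rewrite lee_fin -/h ler_pdivrMr ?ltr0n//.
  rewrite [leRHS](_ : _ = h `^ s * (N%:R / m `^ s)); last first.
    by rewrite powRM ?invr_ge0 ?(ltW h0) ?(ltW m_gt0)// -powR_inv1 1?ltW//
      -powRrM mulN1r powRN; ring.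
  by rewrite ler_peMr ?(ltW hs0)// ler_pdivlMr ?powR_gt0// mul1r.
- by move=> k theta ytheta rtheta; apply: (tV k); exists theta.
Qed.

Let len l j : R := l / m ^+ j.

Let len_gt0 l j : 0 < l -> 0 < len l j.
Proof. by move=> l0; rewrite divr_gt0// exprn_gt0. Qed.

Let lenS l j : len l j.+1 = len l j / m.
Proof. by rewrite /len exprSr invfM mulrA. Qed.

Let len_lt l e : 0 < l -> 0 < e -> exists j, len l j < e.
Proof.
move=> l0 e0; have le0 : 0 <= l / e by rewrite divr_ge0// ltW.
exists (Num.bound (l / e)); rewrite /len ltr_pdivrMr ?exprn_gt0// mulrC.
rewrite -ltr_pdivrMr//; apply: lt_le_trans (archi_boundP le0) _.
move: (Num.bound _) => n; apply: (@le_trans _ _ (2 ^+ n)).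
  by rewrite -natrX ler_nat ltnW// ltn_expl.
by rewrite lerXn2r ?nnegrE//; have := m_ge4; lra.
Qed.

(** The common point of the nested segments built from the light children. An
    exponent k has returns at the first generation j at which the power expands
    the segment to a length at most 1 / 4, except for the finitely many k for
    which this already holds, with a length at most 1 / (4 m), at the start. *)
Lemma exists_escape x l : a <= x -> 0 < l ->
  (meeting_weight w U (seg x l) < ((l / m) `^ s)%:E)%E ->
  exists theta, [/\ seg x l theta, forall k, ~ U k theta &
    exists n, forall k, (n <= k)%N ->
      ~ (0 < fractional (theta ^+ k) < (4 * m ^+ 2)^-1)].
Proof.
move=> ax l0 Ul.
pose inv j y := a <= y /\
  (meeting_weight w U (seg y (len l j)) < ((len l j / m) `^ s)%:E)%E.
have /choice[f fP] (jy : nat * R) : exists z, inv jy.1 jy.2 ->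
    [/\ jy.2 <= z, z + len l jy.1.+1 <= jy.2 + len l jy.1, inv jy.1.+1 z &
    forall k theta, seg z (len l jy.1.+1) theta ->
      ~ returns m jy.2 (len l jy.1) k theta].
  case: jy => j y /=.
  have [[ay Uy]|] := pselect (inv j y); last by exists 0.
  have [z [yz zy Uz rz]] := exists_next_seg ay (len_gt0 j l0) Uy.
  exists z => _; rewrite /inv !lenS; split=> //; split=> //.
  exact: le_trans yz.
pose xs := fix xs j := if j is i.+1 then f (i, xs i) else x.
have xsP j : inv j (xs j).
  elim: j => [|j IH]; first by rewrite /inv /len expr0 divr1.
  by have [] := fP (j, xs j) IH.
have xs_le j : xs j <= xs j.+1 by have [] := fP (j, xs j) (xsP j).
have xs_ge j : xs j.+1 + len l j.+1 <= xs j + len l j.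
  by have [] := fP (j, xs j) (xsP j).
have nd_xs : {homo xs : i j / (i <= j)%N >-> i <= j}.
  by apply/nondecreasing_seqP.
have ni_xs : {homo (fun j => xs j + len l j) : i j / (i <= j)%N >-> j <= i}.
  exact/nonincreasing_seqP.
have xs_lt i j : xs i <= xs j + len l j.
  apply: le_trans (ni_xs _ _ (leq_maxr i j)).
  apply: le_trans (nd_xs _ _ (leq_maxl i j)) _.
  by rewrite lerDl ltW// len_gt0.
pose theta := sup (range xs).
have theta_seg j : seg (xs j) (len l j) theta.
  rewrite /seg /= in_itv/=; apply/andP; split.
    apply: ub_le_sup; last by exists j.
    by exists (xs 0%N + len l 0) => _ [i _ <-].
  by apply: ge_sup; [exists (xs 0%N); exists 0%N|move=> _ [i _ <-]].
exists theta; split.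
- by have := theta_seg 0%N; rewrite /= /len expr0 divr1.
- move=> k Utheta.
  have w_lt j : w k < (len l j / m) `^ s.
    have [_] := xsP j; rewrite -lte_fin; apply: le_lt_trans.
    by apply: le_meeting_weight => //; exists theta.
  have [s0|s0] := eqVneq s 0.
    (* the thresholds do not tend to 0, but 0 `^ 0 = 1 gives w k >= 1 *)
    have := dist_le_w Utheta Utheta; have := w_lt 0%N.
    by rewrite s0 !powRr0; lra.
  have s_gt0 : 0 < s by rewrite lt0r s0.
  have ws0 : 0 < w k `^ s^-1 by exact: powR_gt0.
  have [j ltj] := len_lt l0 ws0.
  have := w_lt j; apply/negP; rewrite -leNgt.
  rewrite -[leRHS](powRr1 (w_ge0 k)) -(mulVf s0) powRrM.
  have lenj0 := len_gt0 j l0; have lm0 : 0 < len l j / m by exact: divr_gt0.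
  apply: ge0_ler_powR; rewrite ?nnegrE ?(ltW ws0) ?(ltW lm0)//.
  apply: le_trans (ltW ltj); rewrite ler_piMr ?(ltW lenj0)//.
  by rewrite invf_le1//; have := m_ge4; lra.
pose b := ((4 * m)^-1 / l); have b0 : 0 <= b.
  by rewrite !mulr_ge0 ?invr_ge0// ?mulr_ge0// ltW.
exists (Num.bound b).+1 => k bk /andP[t0 te].
have speed_le y z : 0 <= y -> y <= z -> speed k y <= speed k z.
  by move=> y0 yz; rewrite /speed ler_wpM2l// lerXn2r ?nnegrE//; lra.
have xs1 j : 1 <= xs j.
  by have [axj _] := xsP j; exact: le_trans (ltW a_gt1) axj.
have [j0 j0P] : exists j, len l j * speed k (xs j) <= 4^-1.
  have S0 : 0 < speed k (x + l).
    by rewrite mulr_gt0 ?ltr0n ?exprn_gt0//; [lia|have := xs1 0%N; rewrite /=; lra].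
  have [|j ltj] := @len_lt l (4^-1 / speed k (x + l)) l0.
    by rewrite divr_gt0.
  exists j; apply: (@le_trans _ _ (len l j * speed k (x + l))); last first.
    by rewrite -ler_pdivlMr// ltW.
  rewrite ler_wpM2l ?(ltW (len_gt0 _ _))// speed_le//; first by have := xs1 j; lra.
  by have := xs_lt j 0%N; rewrite /= /len expr0 divr1.
have [j jP j_min] := ex_minnP (ex_intro (fun j => _ <= _) j0 j0P).
have [_ _ _ /(_ k theta (theta_seg j.+1))] := fP (j, xs j) (xsP j).
apply; split => /=; [exact: theta_seg| |by rewrite t0 te].
rewrite jP andbT; case: j jP j_min => [|j] jP j_min.
  rewrite /len expr0 divr1 [l * _]mulrC -ltr_pdivrMr//= -/b.
  apply: lt_le_trans (archi_boundP b0) _.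
  apply: (@le_trans _ _ k%:R); first by rewrite ler_nat; lia.
  by rewrite /speed ler_peMr// exprn_ege1//; exact: (xs1 0%N).
have : 4^-1 < len l j * speed k (xs j).
  by rewrite ltNge; apply/negP => /j_min; rewrite ltnn.
have : len l j * speed k (xs j) <= len l j * speed k (xs j.+1).
  rewrite ler_wpM2l ?(ltW (len_gt0 _ _))// speed_le//.
  by have := xs1 j; lra.
move=> le1 lt1; rewrite lenS mulrAC ltr_pdivlMr// invfM mulfVK ?gt_eqF//.
exact: lt_le_trans le1.
Qed.

End escape.

(** * The dimension *)

Section nondense.
Context {R : realType}.
Implicit Types (a s e : R) (u : R^nat).

Lemma branching_exists a s : 1 < a -> 0 <= s -> s < 1 ->
  exists N, [/\ (0 < N)%N, (4 * N)%:R <= a ^+ N & (4 * N)%:R `^ s <= N%:R :> R].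
Proof.
move=> a1 s0 s1; have a0 : 0 <= a by lra.
pose b := Num.sqrt a; have b1 : 0 < b - 1.
  by rewrite subr_gt0 /b -sqrtr1 ltr_sqrt//; lra.
pose T : R := (4 `^ s) `^ (1 - s)^-1; pose B := T + 4 / (b - 1) ^+ 2.
have T0 : 0 <= T by exact: powR_ge0.
have b20 : 0 < (b - 1) ^+ 2 by rewrite exprn_gt0.
have b40 : 0 <= 4 / (b - 1) ^+ 2 by rewrite divr_ge0 ?(ltW b20).
have B0 : 0 <= B by exact: addr_ge0.
have := archi_boundP B0; set N := Num.bound B => BN.
have N0 : 0 < N%:R :> R by exact: le_lt_trans BN.
exists N; split; first by rewrite -(ltr0n R).
  have bN : N%:R * (b - 1) <= b ^+ N.
    have := @subrX_ge_speed R N 1 b ler01 _; rewrite /speed !expr1n mulr1.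
    by move=> /(_ _)/le_trans; apply; [lra|rewrite gerBl].
  have -> : a ^+ N = b ^+ N * b ^+ N by rewrite -exprMn -expr2 sqr_sqrtr.
  apply: le_trans (ler_pM _ _ bN bN); try by rewrite mulr_ge0 ?(ltW N0) ?(ltW b1).
  rewrite natrM [leRHS](_ : _ = (N%:R * (b - 1) ^+ 2) * N%:R); last by ring.
  rewrite ler_wpM2r ?(ltW N0)// -ler_pdivrMr//.
  by apply: le_trans (ltW BN); rewrite lerDr.
have TN : 4 `^ s <= N%:R `^ (1 - s).
  rewrite (_ : 4 `^ s = T `^ (1 - s)); last first.
    by rewrite /T -powRrM mulVf ?powRr1 ?powR_ge0// gt_eqF// subr_gt0.
  apply: ge0_ler_powR; rewrite ?nnegrE ?(ltW N0) ?subr_ge0 ?(ltW s1)//.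
  by apply: le_trans (ltW BN); rewrite lerDl.
rewrite natrM powRM ?(ltW N0)//.
apply: le_trans (ler_wpM2r (powR_ge0 _ _) TN) _.
by rewrite -powRD ?subrK ?powRr1 ?(ltW N0)// oner_eq0.
Qed.

(** Finitely many terms cannot restore density: shrinking e below their nonzero
    fractional parts leaves the whole sequence outside ]0, e[ modulo 1. *)
Lemma not_dense_mod1 u e (n : nat) : 0 < e ->
  (forall k, (n <= k)%N -> ~ (0 < fractional (u k) < e)) -> ~ dense_mod1 u.
Proof.
elim: n e => [|n IH] e e0 ue.
  move=> /dense_mod1_fractional du.
  pose x : R := Num.min 1 e / 2.
  have [x0 xe x1] : [/\ 0 < x, 2 * x <= e & 2 * x <= 1].
    have -> : 2 * x = Num.min 1 e by rewrite /x; field.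
    by rewrite divr_gt0 ?lt_min ?e0 ?ltr01// !ge_min !lexx orbT.
  have [|_ [[k _ <-] /= xk]] := du x _ (ball x x) (nbhsx_ballx _ _ x0).
    by rewrite /= in_itv/=; apply/andP; split; lra.
  apply: (ue k) => //; move: xk; rewrite /ball/= -/(fractional (u k)).
  by rewrite ltr_distlC => /andP[xk kx]; apply/andP; split; lra.
have [un0|/negP un0] := boolP (0 < fractional (u n)); last first.
  apply: (IH e e0) => k; rewrite leq_eqVlt => /predU1P[<- /andP[]//|].
  exact: ue.
apply: (IH (Num.min e (fractional (u n)))); first by rewrite lt_min e0.
move=> k; rewrite lt_min leq_eqVlt => /predU1P[<-|nk].
  by rewrite ltxx andbF => /andP[].
by move=> /and3P[k0 ke _]; apply: (ue k nk); rewrite k0.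
Qed.

Lemma nondense_powers_not_null a l s : 1 < a -> 0 < l -> 0 <= s -> s < 1 ->
  hausdorff_measure s [set theta | seg a l theta /\
    ~ dense_mod1 (fun k : nat => theta ^+ k)] != 0%E.
Proof.
move=> a1 l0 s0 s1; apply/eqP => H0.
have [N [N0 NaN Ns]] := branching_exists a1 s0 s1.
have m0 : 0 < (4 * N)%:R :> R by rewrite ltr0n; lia.
pose tau : R := (l / (4 * N)%:R) `^ s.
have tau0 : 0 < tau by rewrite powR_gt0// divr_gt0.
have tau20 : 0 < tau / 2 by rewrite divr_gt0.
have [U [cover_U U1 Utau]] := hausdorff_measure_eq0_cover H0 ltr01 tau20.
have wfin k : hausdorff_weight s (U k) \is a fin_num.
  rewrite ge0_fin_numE ?hausdorff_weight_ge0//.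
  by apply: le_lt_trans (hausdorff_weight_le s0 ler01 (U1 k)) (ltry _).
(* weights must be positive, even for the singletons of the cover *)
pose w k := fine (hausdorff_weight s (U k)) + tau / 2 / (2 ^ k.+1)%:R.
have extra0 k : 0 < tau / 2 / (2 ^ k.+1)%:R.
  by rewrite divr_gt0// ltr0n expn_gt0.
have w0 k : 0 < w k.
  by rewrite ltr_wpDl// fine_ge0// hausdorff_weight_ge0.
have dist_w k y z : U k y -> U k z -> `|y - z| `^ s <= w k.
  move=> Uy Uz; apply: (@le_trans _ _ (fine (hausdorff_weight s (U k)))).
    rewrite -lee_fin fineK// /hausdorff_weight ifF; last first.
      by apply/negP => /eqP U0; move: Uy; rewrite U0.
    rewrite -poweR_EFin; apply: gt0_ler_poweR => //.
    - by rewrite in_itv/= leey lee_fin normr_ge0.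
    - by rewrite in_itv/= leey diameter_ge0.
    - exact: dist_le_diameter.
  by rewrite lerDl ltW.
have wtau : (meeting_weight w U (seg a l) < tau%:E)%E.
  apply: (@le_lt_trans _ _ (\sum_(0 <= k <oo) (w k)%:E)%E).
    rewrite /meeting_weight eseries_mkcond; apply: lee_nneseries => k _.
      by move=> _; case: ifP => _; rewrite lee_fin// ltW.
    by case: ifP => _; rewrite lee_fin// ltW.
  under eq_eseriesr do rewrite EFinD fineK//.
  apply: le_lt_trans (epsilon_trick _ _ (ltW tau20)) _.
    by move=> k; exact: hausdorff_weight_ge0.
  by rewrite [tau in ltRHS]splitr EFinD lte_leD.
have [theta [al Utheta [n thetan]]] :=
  exists_escape a1 s0 N0 NaN Ns w0 dist_w (lexx a) l0 wtau.
have [|k _ /Utheta//] := cover_U theta.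
split=> //; apply: not_dense_mod1 thetan.
by rewrite invr_gt0 mulr_gt0// exprn_gt0.
Qed.

End nondense.

Theorem corollary6 (R : realType) (I : set R) (I_open : open I)
  (I_itv : is_interval I) (I_neq0 : I !=set0) (I_gt1 : I `<=` `]1, +oo[) :
  hausdorff_dim
    [set theta | I theta /\ ~ dense_mod1 (fun k : nat => theta ^+ k)] = 1%E.
Proof.
apply/eqP; rewrite eq_le; apply/andP; split.
  apply/lee_addgt0Pr => e e0; rewrite -EFinD; apply: ereal_inf_lbound.
  exists (1 + e) => //; split; first lra.
  apply: (@hausdorff_measure_half_line _ _ _ 1); first lra.
  by move=> theta [/I_gt1 /=]; rewrite !in_itv/= !andbT => /ltW.
apply: le_ereal_inf_tmp => _ [s [s0 sA] <-]; rewrite lee_fin leNgt.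
apply/negP => s1; have [a Ia] := I_neq0.
have a1 : 1 < a by have := I_gt1 _ Ia; rewrite /= in_itv/= andbT.
have /nbhs_ballP[e /= e0 aeI] := open_nbhs_nbhs (conj I_open Ia).
have e20 : 0 < e / 2 by rewrite divr_gt0.
move/eqP: (nondense_powers_not_null a1 e20 s0 s1); apply.
apply: subset_hausdorff_measure_eq0 sA => theta [atheta nd]; split=> //.
move: atheta; rewrite /seg /= in_itv/= => /andP[ale thetae]; apply: aeI.
by rewrite /ball/= ltr_distlC; apply/andP; split; lra.
Qed.
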